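(* Let $\mathsf{P}\subset\mathrm{Top}$ be a full subcategory containing all compact Hausdorff spaces, such that $\mathbb{R}\in\mathsf{P}$ and every object of $\mathsf{P}$ is realcompact. Let $X$ be a completely regular Hausdorff topological space. Then the following assertions are equivalent: (i) $X$ admits a functorial $\mathsf{P}$-ification. (ii) $\upsilon X\in\mathsf{P}$. (iii) There exists an object $Y\in\mathsf{P}$ such that $C(X)$ is isomorphic as a ring to $C(Y)$. Moreover, if (iii) holds for an object $Y\in\mathsf{P}$, then the functorial $\mathsf{P}$-ification of $X$ coincides with $Y$ (up to homeomorphism).
   Context: $\mathrm{Top}$ denotes the category of completely regular Hausdorff topological spaces and continuous maps; all spaces are assumed to be such. Full subcategories $\mathsf{P}\subset\mathrm{Top}$ stand for topological properties, hence are understood to be closed under homeomorphism. A space $X$ admits a functorial $\mathsf{P}$-ification $i_X: X\to\nu_{\mathsf{P}}X$ if $\nu_{\mathsf{P}}X\in\mathsf{P}$, $i_X$ is continuous, and for every $Y\in\mathsf{P}$ and every continuous map $f:X\to Y$ there is a unique continuous map $\tilde f:\nu_{\mathsf{P}}X\to Y$ with $f=\tilde f\circ i_X$. $C(X)$ is the ring of continuous functions $X\to\mathbb{R}$; $\beta X$ is the Stone–Čech compactification. A space is realcompact if it admits a closed embedding into $\mathbb{R}^{\kappa}$ for some cardinal $\kappa$. The realcompactification $\upsilon X\subset\beta X$ is the subspace of all points $x\in\beta X$ such that every continuous map $X\to\mathbb{R}$ extends to a continuous map $X\cup\{x\}\to\mathbb{R}$. *)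

(* Defs.v *)
From HB Require Import structures.
From mathcomp Require Import all_boot all_order all_algebra.
From mathcomp Require Import all_classical all_reals topology normedtype.

Set Implicit Arguments.
Unset Strict Implicit.
Unset Printing Implicit Defensive.

Import Order.TTheory GRing.Theory Num.Theory.
Import numFieldNormedType.Exports.

Local Open Scope classical_set_scope.
Local Open Scope ring_scope.

Section continuous_functions.
Context {T : topologicalType} {R : realType}.
Local Notation CT := (continuousType T R).

Definition cts_pred : {pred T -> R} := mem [set f : T -> R | continuous f].

Section Sub.
Context (f : T -> R) (fP : f \in cts_pred).
Definition cts_Sub_subproof := @isContinuous.Build T R f (set_mem fP).
#[local] HB.instance Definition _ := cts_Sub_subproof.
Definition cts_Sub : CT := f.
End Sub.

Lemma cts_rect (K : CT -> Type) :
  (forall f (Pf : f \in cts_pred), K (cts_Sub Pf)) -> forall u : CT, K u.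
Proof.
move=> Ksub [f [[cf]]]; have := Ksub f (mem_set cf); congr (K _).
exact/continuousEP.
Qed.

Lemma cts_valP f (Pf : f \in cts_pred) : cts_Sub Pf = f :> (T -> R).
Proof. by []. Qed.

HB.instance Definition _ := isSub.Build _ _ CT cts_rect cts_valP.

Lemma cts_subring_closed : subring_closed cts_pred.
Proof.
split=> [|f g|f g]; rewrite !inE/=; first exact: cst_continuous.
- by move=> cf cg x; apply: continuousB; [exact: cf|exact: cg].
- by move=> cf cg x; apply: continuousM; [exact: cf|exact: cg].
Qed.

(* The ring C(T), with pointwise operations; it is the zero ring when T is
   empty, hence a pzRing. *)
HB.instance Definition _ :=
  GRing.SubChoice_isSubComPzRing.Build (T -> R) cts_pred CT cts_subring_closed.

End continuous_functions.

Definition ring_isomorphic (A B : pzRingType) : Prop :=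
  exists phi : {rmorphism A -> B}, bijective phi.

(* [completely_regular_space] is phrased with uniform separators; by
   [uniform_separatorP] this is separation by functions into [0, 1]. *)
Definition completely_regular_hausdorff (T : topologicalType) : Prop :=
  completely_regular_space T /\ hausdorff_space T.

Definition homeomorphic (X Y : topologicalType) : Prop :=
  exists (f : X -> Y) (g : Y -> X),
    [/\ continuous f, continuous g, cancel f g & cancel g f].

Definition closed_embedding (X Y : topologicalType) (f : X -> Y) : Prop :=
  [/\ injective f,
      forall U : set X, open U <-> open (U : set (initial_topology f)) &
      closed (range f)].

Definition realcompact (R : realType) (X : topologicalType) : Prop :=
  exists (K : Type) (f : X -> {ptws K -> R}), closed_embedding f.

Section stone_cech.
Variables (R : realType) (X : topologicalType).

Definition unit_functions : set (continuousType X R) :=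
  [set f | range f `<=` `[0, 1] ].

Definition unit_evaluation : X -> {ptws unit_functions -> R} :=
  join_product (fun f : unit_functions => set_val f : X -> R).

(* beta X as the closure of the image of X in the cube [0,1]^C(X,[0,1]). *)
Definition stone_cech : topologicalType :=
  set_type (closure (range unit_evaluation)).

Definition to_stone_cech (x : X) : stone_cech :=
  SigSub (mem_set (subset_closure (imageT unit_evaluation x))).

(* X is identified with its image in beta X. [{within A, continuous g}] only
   depends on the restriction of g to A, so the values of g off
   X `|` [set p] play no role. *)
Definition upsilon_set : set stone_cech :=
  [set p | forall f : X -> R, continuous f ->
    exists g : stone_cech -> R,
      {within range to_stone_cech `|` [set p], continuous g} /\
      f = g \o to_stone_cech].

Definition realcompactification : topologicalType := set_type upsilon_set.

End stone_cech.

Arguments unit_functions : clear implicits.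
Arguments upsilon_set : clear implicits.

Definition is_Pification (P : topologicalType -> Prop) (X nuX : topologicalType)
    (i : X -> nuX) : Prop :=
  [/\ P nuX, continuous i &
      forall (Y : topologicalType) (f : X -> Y), P Y -> continuous f ->
        exists! g : nuX -> Y, continuous g /\ f = g \o i].

Definition admits_Pification (P : topologicalType -> Prop)
    (X : topologicalType) : Prop :=
  exists (nuX : topologicalType) (i : X -> nuX), is_Pification P i.

(* Main.v *)
Require Import Defs.
From HB Require Import structures.
From mathcomp Require Import all_boot all_order all_algebra.
From mathcomp Require Import all_classical all_reals topology normedtype.
From mathcomp Require Import ring lra.
Import Order.TTheory GRing.Theory Num.Theory.
Import numFieldNormedType.Exports.
Set Implicit Arguments.
Unset Strict Implicit.
Unset Printing Implicit Defensive.
Local Open Scope classical_set_scope.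
Local Open Scope ring_scope.

(** The theorem rests on the duality between realcompact spaces and their
    rings of continuous functions. A character of C(T) is a unital ring
    morphism from C(T) to the reals. A space T is a Hewitt space when C(T)
    separates its points and induces its topology, and every character of
    C(T) is the evaluation at a point. For a Hewitt space Y, every ring
    morphism from C(Y) to C(X) is the pullback along a continuous map X -> Y
    ([hewitt_duality]): composing it with the evaluation at x gives a
    character of C(Y), hence a point of Y. Two consequences follow. Hewitt
    spaces with isomorphic rings are homeomorphic ([hewitt_homeomorphic]). If
    e : X -> N induces a bijection from C(N) to C(X), then N has the universal
    property of a reflection of X with respect to Hewitt spaces
    ([hewitt_extension]).

    Both kinds of spaces in the theorem are Hewitt spaces. For a character chi
    of C(T), the sets [f < 1] with chi f = 0 generate a proper filter along
    which each continuous g tends to chi g: if f >= 1 everywhere, then f is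
    invertible and chi f is not 0. Hence chi is the evaluation at any limit of
    this filter. When T is closed in a power of the reals, the coordinates
    converge along the filter, so the filter does ([realcompact_hewitt]). In
    the realcompactification, the limit exists in the Stone-Cech cube, and it
    stays in the realcompactification because of the following description.
    Each f in C(X) is a quotient (k - 1/2) / h of [0, 1]-valued functions, with
    h = 1 / (1 + f ^ 2) and k = f h + 1/2, and f extends continuously to a
    point p of beta X if and only if the extension of h does not vanish at p.
    So p lies in the realcompactification as soon as no such h vanishes there,
    and a character of the ring of the realcompactification sends the
    invertible h to a nonzero number ([upsilon_hewitt]). The same quotients
    show that restriction identifies the ring of the realcompactification with
    C(X) ([pullback_to_upsilon_bijective]).

    The theorem is then formal. A P-ification nu of X has C(nu) isomorphic to
    C(X), by its universal property for the real line, so (i) gives (iii);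
    under (iii), Y and the realcompactification are Hewitt spaces with
    isomorphic rings, which gives (ii); under (ii), the realcompactification
    has the universal property, which gives (i). Under (iii), the P-ification
    and Y are likewise homeomorphic. *)

(** * Characters of rings of continuous functions *)

(** A ring endomorphism of the reals preserves squares, hence the order, and it
    fixes the rationals, which are dense. *)
Lemma real_endo_id (R : realType) (f : {rmorphism R -> R}) x : f x = x.
Proof.
have homo : {homo f : a b / a <= b}.
  move=> a b ab; rewrite -subr_ge0 -rmorphB.
  rewrite -(sqr_sqrtr (_ : 0 <= b - a)) ?subr_ge0//.
  by rewrite rmorphXn sqr_ge0.
apply/eqP; case: (ltgtP (f x) x) => // fx.
- have [q] := rat_in_itvoo fx; rewrite in_itv/= => /andP[fq qx].
  by have := homo _ _ (ltW qx); rewrite fmorph_rat leNgt fq.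
- have [q] := rat_in_itvoo fx; rewrite in_itv/= => /andP[fq qx].
  by have := homo _ _ (ltW fq); rewrite fmorph_rat leNgt qx.
Qed.

Section Characters.
Variables (R : realType) (T : topologicalType).
Local Notation C T := (continuousType T R).

Lemma ctsD (f g : C T) t : (f + g) t = f t + g t. Proof. by []. Qed.
Lemma ctsM (f g : C T) t : (f * g) t = f t * g t. Proof. by []. Qed.
Lemma cts1 t : (1 : C T) t = 1. Proof. by []. Qed.
Lemma ctsB (f g : C T) t : (f - g) t = f t - g t. Proof. by []. Qed.
Lemma ctsX (f : C T) n t : (f ^+ n) t = f t ^+ n.
Proof. by elim: n => [|n IH]; rewrite ?expr0 // !exprS ctsM IH. Qed.

Definition cts_cst (c : R) : C T := cst c.
Fact cts_cst_zmod : zmod_morphism cts_cst.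
Proof. by move=> a b; apply/continuousEP. Qed.
Fact cts_cst_monoid : monoid_morphism cts_cst.
Proof. by split=> [|a b]; apply/continuousEP. Qed.
HB.instance Definition _ :=
  GRing.isZmodMorphism.Build R (C T) cts_cst cts_cst_zmod.
HB.instance Definition _ :=
  GRing.isMonoidMorphism.Build R (C T) cts_cst cts_cst_monoid.

Lemma character_cst (chi : {rmorphism C T -> R}) c : chi (cts_cst c) = c.
Proof. exact: (real_endo_id (chi \o cts_cst)). Qed.

Lemma reciprocal_subproof (f : C T) :
  (forall t, f t != 0) -> continuous (fun t => (f t)^-1).
Proof. by move=> f0 t; apply: cvgV => //; exact: cts_fun. Qed.

Definition reciprocal (f : C T) (f0 : forall t, f t != 0) : C T :=
  mkcts (reciprocal_subproof f0).

Lemma character_neq0 (chi : {rmorphism C T -> R}) (f : C T) :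
  (forall t, f t != 0) -> chi f != 0.
Proof.
move=> f0; apply: contra_eq_neq (rmorph1 chi) => chif.
have <- : f * reciprocal f0 = 1 by apply/continuousEP => t; rewrite ctsM mulfV.
by rewrite rmorphM chif mul0r eq_sym oner_eq0.
Qed.
End Characters.

Section CharacterFilter.
Variables (R : realType) (T : topologicalType).
Local Notation C T := (continuousType T R).
Variable chi : {rmorphism C T -> R}.

(** The sets [f < 1], with f in the kernel of chi, play the role of the
    neighbourhoods of the point at which chi would be the evaluation. *)
Definition character_filter : set_system T :=
  [set A | exists2 f : C T, chi f = 0 & [set t | f t < 1] `<=` A].

(** The sets are nonempty because a function with values at least 1 is
    invertible; the set of f ^ 2 + g ^ 2 is contained in those of f and g. *)
#[global] Instance character_filter_proper : ProperFilter character_filter.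
Proof.
split.
  case=> f chif f0; have f1 t : 1 <= f t.
    by rewrite leNgt; apply/negP => ft; exact: (f0 t ft).
  have := @character_neq0 R T chi f; rewrite chif eqxx.
  move=> /(_ _)/notF; apply => t.
  by rewrite gt_eqF// (lt_le_trans ltr01).
split.
- by exists 0; rewrite ?rmorph0.
- move=> A B [f chif fA] [g chig gB]; exists (f ^+ 2 + g ^+ 2).
    by rewrite rmorphD !rmorphXn /= chif chig expr0n addr0.
  have lt1 (a b : R) : a ^+ 2 + b ^+ 2 < 1 -> a < 1.
    move=> ab; rewrite (le_lt_trans (ler_norm a))//.
    rewrite -(@expr_lt1 _ 2)// real_normK ?num_real//.
    by rewrite (le_lt_trans _ ab)// lerDl sqr_ge0.
  move=> t; rewrite [X in X -> _]/mkset ctsD !ctsX => fg.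
  split; first exact/fA/(lt1 _ _ fg).
  by apply/gB/(lt1 _ (f t)); rewrite addrC.
- by move=> A B AB [f chif fA]; exists f => //; exact: subset_trans AB.
Qed.

Lemma cvg_character_filter (g : C T) : g @ character_filter --> chi g.
Proof.
apply/cvgrPdist_lt => e e0.
(* The set where this square is less than 1 is [|g - chi g| < e]. *)
exists ((cts_cst T e^-1 * (cts_cst T (chi g) - g)) ^+ 2).
  by rewrite rmorphXn rmorphM rmorphB /= !character_cst subrr mulr0 expr0n.
move=> t; rewrite [X in X -> _]/mkset ctsX ctsM ctsB /cts_cst exprMn => lt1 /=.
rewrite -ltr_sqr ?nnegrE ?(ltW e0)// real_normK ?num_real//.
by move: lt1; rewrite exprVn mulrC ltr_pdivrMr ?exprn_gt0// mul1r.
Qed.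

End CharacterFilter.

(** * Hewitt spaces *)

Section Hewitt.
Variable R : realType.
Local Notation C T := (continuousType T R).

(** The second condition says that the topology of T is the one induced by C(T);
    stated for filters, it gives both the continuity of maps into T and the
    convergence of the filters of characters. *)
Record hewitt_space (T : topologicalType) : Prop := HewittSpace {
  hewitt_separated : forall s t : T, (forall g : C T, g s = g t) -> s = t;
  hewitt_cvg : forall (F : set_system T) (t : T), Filter F ->
    (forall g : C T, g @ F --> g t) -> F --> t;
  hewitt_character : forall chi : {rmorphism C T -> R},
    exists t, forall g, chi g = g t }.

(** It suffices to check the conditions on a family c of functions: if a
    character is the evaluation at t on c, then its filter converges to t, so
    that every g converges along it both to g t and to its image by the
    character. *)
Lemma hewitt_of_family (T : topologicalType) (K : Type) (c : K -> C T) :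
  (forall s t, (forall k, c k s = c k t) -> s = t) ->
  (forall (F : set_system T) t, Filter F ->
    (forall k, c k @ F --> c k t) -> F --> t) ->
  (forall chi : {rmorphism C T -> R}, exists t, forall k, chi (c k) = c k t) ->
  hewitt_space T.
Proof.
move=> sep gen char; split.
- by move=> s t st; apply: sep => k; exact: st.
- by move=> F t FF gt; apply: gen => // k; exact: gt.
- move=> chi; have [t chit] := char chi; exists t => g.
  have Ft : character_filter chi --> t.
    by apply: gen => k; rewrite -chit; exact: cvg_character_filter.
  apply: (@cvg_unique _ _ (g @ character_filter chi)).
  + exact: norm_hausdorff.
  + exact: cvg_character_filter.
  + exact: cvg_comp Ft (@cts_fun _ _ g t).
Qed.

Lemma cvg_ptws (S K : Type) (F : set_system S) (u : S -> {ptws K -> R})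
    (z : {ptws K -> R}) : Filter F ->
  (forall k, (fun s => u s k) @ F --> z k) -> u @ F --> z.
Proof.
move=> FF uz; apply/cvg_sup => k A [_ [[B oB <-] zB BA]].
by apply: filterS BA _; apply: uz; exact: open_nbhs_nbhs.
Qed.

Lemma ptws_coord_continuous (K : Type) (k : K) :
  continuous (fun z : {ptws K -> R} => z k).
Proof.
move=> z A zA; have /cvg_sup/(_ k) zk : nbhs z --> z := @cvg_id _ (nbhs z).
apply: zk; exact: (@initial_continuous {ptws K -> R} R (@^~ k) z).
Qed.

(** The coordinates of a closed embedding converge along the filter of a
    character, and their limit is in the image since the image is closed. *)
Lemma realcompact_hewitt (T : topologicalType) :
  realcompact R T -> hewitt_space T.
Proof.
case=> K [j [jinj jopen jclosed]].
have jcts : continuous j.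
  by apply/continuousP => A oA; apply/jopen; exists A.
have jcvg (F : set_system T) t : Filter F -> j @ F --> j t -> F --> t.
  move=> FF jF A; rewrite nbhsE => -[U [oU Ut] UA].
  have [B oB BU] := (jopen U).1 oU; apply: filterS UA _; rewrite -BU.
  by apply: jF; apply: open_nbhs_nbhs; split => //; move: Ut; rewrite -BU.
have ccts k : continuous (fun t => j t k).
  move=> t.
  exact: (continuous_comp (jcts t) (@ptws_coord_continuous K k (j t))).
apply: (@hewitt_of_family T K (fun k => mkcts (ccts k))).
- by move=> s t st; apply: jinj; apply/funext => k; exact: st.
- by move=> F t FF cF; apply: jcvg => //; apply: cvg_ptws => k; exact: cF.
- move=> chi; pose z : {ptws K -> R} := fun k => chi (mkcts (ccts k)).
  have jz : j @ character_filter chi --> z.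
    apply: cvg_ptws => k.
    exact: (@cvg_character_filter R T chi (mkcts (ccts k))).
  have [t _ jtz] : range j z.
    apply: (closed_cvg (range j) jclosed _ z jz).
    by apply: nearW => t; exists t.
  by exists t => k; exact: (congr1 (@^~ k) (esym jtz)).
Qed.

Definition pullback (X Y : topologicalType) (u : continuousType X Y)
    (g : C Y) : C X :=
  g \o u.

Section Pullback.
Variables (X Y : topologicalType) (u : continuousType X Y).
Fact pullback_zmod : zmod_morphism (pullback u).
Proof. by move=> a b; apply/continuousEP. Qed.
Fact pullback_monoid : monoid_morphism (pullback u).
Proof. by split=> [|a b]; apply/continuousEP. Qed.
HB.instance Definition _ :=
  GRing.isZmodMorphism.Build (C Y) (C X) (pullback u) pullback_zmod.
HB.instance Definition _ :=
  GRing.isMonoidMorphism.Build (C Y) (C X) (pullback u) pullback_monoid.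
End Pullback.

Definition evaluation (X : topologicalType) (x : X) (g : C X) : R := g x.
Section Evaluation.
Variables (X : topologicalType) (x : X).
Fact evaluation_zmod : zmod_morphism (evaluation x).
Proof. by []. Qed.
Fact evaluation_monoid : monoid_morphism (evaluation x).
Proof. by []. Qed.
HB.instance Definition _ :=
  GRing.isZmodMorphism.Build (C X) R (evaluation x) evaluation_zmod.
HB.instance Definition _ :=
  GRing.isMonoidMorphism.Build (C X) R (evaluation x) evaluation_monoid.
End Evaluation.

(** The point u x represents the character g |-> phi g x of C(Y). *)
Lemma hewitt_duality (X Y : topologicalType) (phi : {rmorphism C Y -> C X}) :
  hewitt_space Y -> exists u : continuousType X Y, phi =1 pullback u.
Proof.
move=> hY.
have /choice[u uE] (x : X) : exists y, forall g, phi g x = g y.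
  exact: (hewitt_character hY (evaluation x \o phi)).
have ucts : continuous u.
  move=> x; apply: (hewitt_cvg hY) => g.
  rewrite -uE; apply: cvg_trans (@cts_fun _ _ (phi g) x).
  by rewrite (_ : phi g = g \o u :> (X -> R))//; apply/funext => z; exact: uE.
by exists (mkcts ucts) => g; apply/continuousEP => x; exact: uE.
Qed.

Lemma pullback_faithful (X Y : topologicalType) (u v : X -> Y) :
  hewitt_space Y -> (forall g : C Y, g \o u = g \o v) -> u = v.
Proof.
move=> hY uv; apply/funext => x; apply: (hewitt_separated hY) => g.
exact: (congr1 (@^~ x) (uv g)).
Qed.

End Hewitt.

(** * Consequences of the duality *)

Lemma rmorphism_inverse (A B : pzRingType) (phi : {rmorphism A -> B}) :
  bijective phi ->
  exists2 psi : {rmorphism B -> A}, cancel phi psi & cancel psi phi.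
Proof.
case=> psi phiK psiK.
pose z := GRing.isZmodMorphism.Build B A psi (can2_zmod_morphism phiK psiK).
pose m := GRing.isMonoidMorphism.Build B A psi (can2_monoid_morphism phiK psiK).
pose Psi : {rmorphism B -> A} := HB.pack psi z m.
by exists Psi.
Qed.

Lemma ring_isomorphic_sym (A B : pzRingType) :
  ring_isomorphic A B -> ring_isomorphic B A.
Proof.
case=> phi /rmorphism_inverse[psi phiK psiK]; exists psi.
by exists phi.
Qed.

Lemma ring_isomorphic_trans (A B D : pzRingType) :
  ring_isomorphic A B -> ring_isomorphic B D -> ring_isomorphic A D.
Proof.
by case=> phi bphi [psi bpsi]; exists (psi \o phi); exact: bij_comp.
Qed.

Section Consequences.
Variable R : realType.
Local Notation C T := (continuousType T R).

Lemma hewitt_homeomorphic (Y Z : topologicalType) :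
  hewitt_space R Y -> hewitt_space R Z -> ring_isomorphic (C Y) (C Z) ->
  homeomorphic Y Z.
Proof.
move=> hY hZ [phi /rmorphism_inverse[psi phiK psiK]].
have [u uE] := hewitt_duality phi hY.
have [v vE] := hewitt_duality psi hZ.
exists v, u; split; try exact: cts_fun.
- move=> y; apply: (hewitt_separated hY) => g.
  by rewrite -[RHS](congr1 (fun h : C Y => h y) (phiK g)) uE vE.
- move=> z; apply: (hewitt_separated hZ) => g.
  by rewrite -[RHS](congr1 (fun h : C Z => h z) (psiK g)) vE uE.
Qed.

(** The extension of f is dual to the morphism which pulls a function on Y back
    to X along f and then extends it to N. *)
Lemma hewitt_extension (X N Y : topologicalType) (e : continuousType X N)
    (f : X -> Y) :
  bijective (pullback (R := R) e) -> hewitt_space R Y -> continuous f ->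
  exists! g : N -> Y, continuous g /\ f = g \o e.
Proof.
move=> bij hY fcts; have einj := bij_inj bij.
have [psi _ psiK] := rmorphism_inverse bij.
have [g gE] :=
  hewitt_duality (psi \o pullback (R := R) (mkcts fcts)) hY.
have fE : f = g \o e.
  apply: (pullback_faithful hY) => h; apply/funext => x.
  have fpsi :=
    congr1 (fun k : C X => k x) (psiK (pullback (mkcts fcts) h)).
  by rewrite -[LHS]fpsi; exact: (congr1 (fun k : C N => k (e x)) (gE h)).
exists g; split=> [|g' [g'cts fE']]; first by split => //; exact: cts_fun.
apply: (pullback_faithful hY) => h.
have /einj :
    pullback e (pullback g h) = pullback e (pullback (mkcts g'cts) h).
  apply/continuousEP => x; congr (h _).
  exact: (congr1 (@^~ x) (etrans (esym fE) fE')).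
by move/(congr1 (fun k : C N => k : N -> R)).
Qed.

(** The universal property for maps to the real line says that the pullback
    along i is a bijection from C(N) to C(X). *)
Lemma Pification_ring_isomorphic (P : topologicalType -> Prop)
    (X N : topologicalType) (i : X -> N) : P R -> is_Pification P i ->
  ring_isomorphic (C X) (C N).
Proof.
move=> PR [_ icts ext]; apply: ring_isomorphic_sym.
exists (pullback (mkcts icts)).
have /choice[E EE] (f : C X) : exists F : C N, pullback (mkcts icts) F = f.
  have [F [[Fcts fF] _]] := ext _ f PR (@cts_fun _ _ f).
  by exists (mkcts Fcts); apply/continuousEP => x; rewrite fF.
exists E => // F.
have [G [_ uniq]] := ext _ (F \o i) PR (@cts_fun _ _ (pullback (mkcts icts) F)).
have GF : G = F by apply: uniq; split=> //; exact: cts_fun.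
have GE : G = E (pullback (mkcts icts) F).
  apply: uniq; split; first exact: cts_fun.
  exact/esym/(congr1 (fun h : C X => h : X -> R) (EE _)).
by apply/continuousEP => x; exact: (congr1 (@^~ x) (etrans (esym GE) GF)).
Qed.
End Consequences.

(** * The realcompactification *)

Lemma cvg_initial (S : Type) (T : choiceType) (U : topologicalType) (f : T -> U)
    (F : set_system S) (u : S -> T) (t : T) : Filter F ->
  (f \o u) @ F --> f t -> u @ F --> (t : initial_topology f).
Proof.
move=> FF fu A [_ [[B oB <-] Bt BA]]; apply: filterS BA _.
by apply: fu; exact: open_nbhs_nbhs.
Qed.

Lemma continuous_quotient_at (R : realType) (T : topologicalType)
    (a b : T -> R) c t :
  continuous a -> continuous b -> b t != 0 ->
  {for t, continuous (fun s => (a s - c) / b s)}.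
Proof.
move=> acts bcts bt; apply: cvgM; last by apply: cvgV => //; exact: bcts.
by apply: cvgB; [exact: acts|exact: cvg_cst].
Qed.

Section Upsilon.
Variables (R : realType) (X : topologicalType).
Local Notation C T := (continuousType T R).
Local Notation ups := (realcompactification R X).

(** Both bounds express that a (1 + b) ^ 2 and a (1 - b) ^ 2 are nonnegative. *)
Lemma half_shift_bounds (a b : R) : 0 <= a -> a * (1 + b ^+ 2) = 1 ->
  b * a + 2^-1 \in `[0, 1].
Proof.
move=> a0 ab; rewrite in_itv /=.
have := mulr_ge0 a0 (sqr_ge0 (1 + b)).
have := mulr_ge0 a0 (sqr_ge0 (1 - b)).
rewrite (_ : a * (1 - b) ^+ 2 = a * (1 + b ^+ 2) - 2 * (b * a)); last by ring.
rewrite (_ : a * (1 + b) ^+ 2 = a * (1 + b ^+ 2) + 2 * (b * a)); last by ring.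
by rewrite ab; move: (b * a) => m le1 ge1; lra.
Qed.

(** Every f in C(X) is a quotient of [0, 1]-valued functions up to a shift: take
    h = 1 / (1 + f ^ 2) and k = f h + 1/2. *)
Lemma unit_quotient (f : C X) : exists h k : unit_functions R X,
  [/\ forall x, set_val h x * (1 + f x ^+ 2) = 1,
      forall x, set_val h x != 0 &
      forall x, f x * set_val h x = set_val k x - 2^-1].
Proof.
have d0 x : (1 + f ^+ 2 : C X) x != 0.
  by rewrite ctsD ctsX cts1 gt_eqF// ltr_wpDr// sqr_ge0.
have hE x : reciprocal d0 x * (1 + f x ^+ 2) = 1.
  by have := d0 x; rewrite ctsD ctsX cts1 => fx0; rewrite mulVf.
have h0 x : 0 <= reciprocal d0 x.
  by rewrite -(pmulr_lge0 _ (_ : 0 < 1 + f x ^+ 2)) ?hE// ltr_wpDr// sqr_ge0.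
have hP : unit_functions R X (reciprocal d0).
  move=> _ [x _ <-]; rewrite /= in_itv/= h0 /= -(hE x) mulrDr mulr1 lerDl.
  by rewrite mulr_ge0// sqr_ge0.
pose k : C X := f * reciprocal d0 + cts_cst X 2^-1.
have kE x : k x = f x * reciprocal d0 x + 2^-1 by [].
have kP : unit_functions R X k.
  move=> _ [x _ <-]; rewrite kE; exact: half_shift_bounds (h0 x) (hE x).
have hx0 x : reciprocal d0 x != 0.
  by apply: contra_eq_neq (hE x) => ->; rewrite mul0r eq_sym oner_eq0.
exists (SigSub (mem_set hP)), (SigSub (mem_set kP)).
split=> x; [exact: hE|exact: hx0|].
by apply/eqP; rewrite eq_sym subr_eq; apply/eqP; exact: kE.
Qed.

Definition coordinate (h : unit_functions R X) (p : stone_cech R X) : R :=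
  set_val p h.

Lemma coordinate_continuous h : continuous (coordinate h).
Proof.
move=> p; exact: (continuous_comp
  (@initial_continuous (stone_cech R X) {ptws unit_functions R X -> R} set_val p)
  (@ptws_coord_continuous R (unit_functions R X) h (set_val p))).
Qed.

Lemma coordinate_to_stone_cech h x :
  coordinate h (to_stone_cech R x) = set_val h x.
Proof. by []. Qed.

Lemma stone_cech_dense (p : stone_cech R X) (U : set (stone_cech R X)) :
  nbhs p U -> exists x, U (to_stone_cech R x).
Proof.
case=> _ [[B oB <-] Bp BU].
have [_ [[x _ <-] Bx]] := set_mem (valP p) _ (open_nbhs_nbhs (conj oB Bp)).
by exists x; exact: BU.
Qed.

(** If g extends f to p, then the equation h (1 + f ^ 2) = 1 extends to p by
    density of X. *)
Lemma upsilon_coordinate_neq0 (p : stone_cech R X) (f : C X)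
    (h : unit_functions R X) :
  upsilon_set R X p -> (forall x, set_val h x * (1 + f x ^+ 2) = 1) ->
  coordinate h p != 0.
Proof.
move=> /(_ f (@cts_fun _ _ f))[g [gcts fg]] hf; apply/negP => /eqP hp0.
set A := _ `|` _ in gcts; have pA : A p by right.
pose w q := coordinate h q * (1 + g q * g q).
have wcts : {within A, continuous w}.
  move=> q; apply: cvgM.
    by apply: continuous_subspaceT; exact: coordinate_continuous.
  by apply: cvgD; [exact: cvg_cst|apply: cvgM; exact: gcts].
have {}wcts : w @ nbhs (p : subspace A) --> (0 : R).
  by rewrite -[X in _ --> X](mul0r (1 + g p * g p)) -hp0; exact: wcts.
move: wcts => /cvgrPdist_lt/(_ 1 ltr01) near_lt1.
have {near_lt1} : within A (nbhs p) [set q | `|0 - w q| < 1].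
  by rewrite nbhs_subspace_in.
move=> /stone_cech_dense[x] /(_ (or_introl (imageT _ x))) xlt1.
have {xlt1} : `|0 - set_val h x * (1 + f x * f x)| < 1.
  by rewrite (congr1 (@^~ x) fg : f x = g (to_stone_cech R x)).
by rewrite sub0r normrN -expr2 hf normr1 ltxx.
Qed.

(** Conversely, (k - 1/2) / h extends f to every point where h does not
    vanish. *)
Lemma upsilon_of_coordinate (p : stone_cech R X) :
  (forall f : C X, exists h k : unit_functions R X,
    [/\ forall x, set_val h x != 0,
        forall x, f x * set_val h x = set_val k x - 2^-1 &
        coordinate h p != 0]) ->
  upsilon_set R X p.
Proof.
move=> hk f fcts; have [h [k [h0 fhk hp0]]] := hk (mkcts fcts).
exists (fun q => (coordinate k q - 2^-1) / coordinate h q); split; last first.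
  by apply/funext => x; rewrite /= 2!coordinate_to_stone_cech -fhk mulfK.
apply: continuous_in_subspaceT => q; rewrite inE => Aq.
have hq0 : coordinate h q != 0.
  by case: Aq => [[x _ <-]|->]; [exact: h0|exact: hp0].
exact: (@continuous_quotient_at R (stone_cech R X) _ _ 2^-1 q
  (@coordinate_continuous k) (@coordinate_continuous h) hq0).
Qed.

Lemma to_stone_cech_upsilon (x : X) : upsilon_set R X (to_stone_cech R x).
Proof.
apply: upsilon_of_coordinate => f.
have [h [k [hf h0 fhk]]] := unit_quotient f.
by exists h, k; split => //; rewrite coordinate_to_stone_cech.
Qed.

Definition to_upsilon (x : X) : ups :=
  SigSub (mem_set (to_stone_cech_upsilon x)).

Fact upsilon_coordinate_continuous h :
  continuous (coordinate h \o set_val : ups -> R).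
Proof.
move=> q; exact: (continuous_comp
  (@initial_continuous ups (stone_cech R X) set_val q)
  (@coordinate_continuous h (set_val q))).
Qed.

Definition upsilon_coordinate h : C ups :=
  mkcts (@upsilon_coordinate_continuous h).

Lemma upsilon_coordinateE h x :
  upsilon_coordinate h (to_upsilon x) = set_val h x.
Proof. by []. Qed.

Lemma cvg_upsilon (S : Type) (F : set_system S) (u : S -> ups) (q : ups) :
  Filter F ->
  (forall h, upsilon_coordinate h (u s) @[s --> F] --> upsilon_coordinate h q) ->
  u @ F --> q.
Proof.
move=> FF uq; apply: (@cvg_initial S ups (stone_cech R X) set_val) => //.
apply: (@cvg_initial S (stone_cech R X)
  {ptws unit_functions R X -> R} set_val) => //.
by apply: cvg_ptws => h; exact: uq.
Qed.

Lemma to_upsilon_continuous : continuous to_upsilon.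
Proof.
by move=> x; apply: cvg_upsilon => h; exact: (@cts_fun _ _ (set_val h)).
Qed.

Lemma upsilon_dense (F G : C ups) :
  (forall x, F (to_upsilon x) = G (to_upsilon x)) -> F = G.
Proof.
move=> FG; apply/continuousEP => q; apply/eqP; rewrite -subr_eq0.
apply/negPn/negP => FGq.
have nz : nbhs ((F - G) q) [set y : R | y != 0].
  by apply: open_nbhs_nbhs; split; [exact: open_neq|exact: FGq].
have : nbhs q [set r | (F - G) r != 0] := @cts_fun _ _ (F - G) q _ nz.
case=> _ [[B oB <-] Bq BU].
have [x Bx] := stone_cech_dense (open_nbhs_nbhs (conj oB Bq)).
have /negP[] : (F - G) (to_upsilon x) != 0 := BU (to_upsilon x) Bx.
by rewrite ctsB FG subrr.
Qed.

Lemma upsilon_extension (f : C X) :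
  exists F : C ups, forall x, F (to_upsilon x) = f x.
Proof.
have [h [k [hf _ fhk]]] := unit_quotient f.
have h0 q : upsilon_coordinate h q != 0.
  exact: upsilon_coordinate_neq0 (set_mem (valP q)) hf.
exists ((upsilon_coordinate k - cts_cst _ 2^-1) * reciprocal h0) => x.
rewrite ctsM ctsB !upsilon_coordinateE -[cts_cst _ _ _]/(2^-1) -fhk.
rewrite -[reciprocal h0 _]/((set_val h x)^-1).
by rewrite mulfK// -upsilon_coordinateE.
Qed.

Lemma pullback_to_upsilon_bijective :
  bijective (pullback (R := R) (mkcts to_upsilon_continuous)).
Proof.
have /choice[E EE] := upsilon_extension.
exists E => [F|f].
  by apply: upsilon_dense => x; rewrite EE.
by apply/continuousEP => x; exact: EE.
Qed.

(** The values of a character on the coordinates define a point z of the cube.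
    It lies in beta X as a limit of points of beta X, and in the
    realcompactification because the character cannot vanish on the invertible
    functions h. *)
Lemma upsilon_hewitt : hewitt_space R ups.
Proof.
apply: (@hewitt_of_family R ups (unit_functions R X) upsilon_coordinate).
- move=> s t st; apply/val_inj/val_inj/funext => h; exact: st.
- by move=> F q FF cq; apply: (@cvg_upsilon ups F id).
move=> chi.
pose z : {ptws unit_functions R X -> R} := fun h => chi (upsilon_coordinate h).
have zp : closure (range (@unit_evaluation R X)) z.
  have jz : set_val (set_val q) @[q --> character_filter chi] --> z.
    apply: cvg_ptws => h.
    exact: (@cvg_character_filter R ups chi (upsilon_coordinate h)).
  apply: (closed_cvg _ (@closed_closure _ _) _ z jz).
  by apply: nearW => q; exact: set_mem (valP (set_val q)).
pose p : stone_cech R X := SigSub (mem_set zp).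
have pu : upsilon_set R X p.
  apply: upsilon_of_coordinate => f.
  have [h [k [hf h0 fhk]]] := unit_quotient f.
  exists h, k; split => //.
  apply: (@character_neq0 R ups chi (upsilon_coordinate h)) => q.
  exact: upsilon_coordinate_neq0 (set_mem (valP q)) hf.
by exists (SigSub (mem_set pu)).
Qed.
End Upsilon.

(** * The characterization of P-ifications *)

Theorem theorem3p5 (R : realType) (P : topologicalType -> Prop)
    (P_top : forall Y : topologicalType, P Y -> completely_regular_hausdorff Y)
    (P_homeo : forall Y Z : topologicalType, homeomorphic Y Z -> P Y -> P Z)
    (P_compact : forall K : topologicalType,
      compact [set: K] -> hausdorff_space K -> P K)
    (P_R : P R)
    (P_realcompact : forall Y : topologicalType, P Y -> realcompact R Y)
    (X : topologicalType) (X_top : completely_regular_hausdorff X) :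
  [/\ admits_Pification P X <-> P (realcompactification R X),
      P (realcompactification R X) <->
        (exists Y : topologicalType, P Y /\
           ring_isomorphic (continuousType X R) (continuousType Y R)) &
      forall Y : topologicalType, P Y ->
        ring_isomorphic (continuousType X R) (continuousType Y R) ->
        forall (nuX : topologicalType) (i : X -> nuX),
          is_Pification P i -> homeomorphic nuX Y].
Proof.
have hewittP Y : P Y -> hewitt_space R Y.
  by move=> /P_realcompact/realcompact_hewitt.
have isoU : ring_isomorphic (continuousType (realcompactification R X) R)
    (continuousType X R).
  exists (pullback (mkcts (@to_upsilon_continuous R X))).
  exact: pullback_to_upsilon_bijective.
have iii_ii Y : P Y ->
    ring_isomorphic (continuousType X R) (continuousType Y R) ->
    P (realcompactification R X).
  move=> PY XY; apply: (P_homeo _ _ _ PY).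
  apply: (hewitt_homeomorphic (hewittP _ PY) (@upsilon_hewitt R X)).
  exact/ring_isomorphic_sym/(ring_isomorphic_trans isoU).
split; first split.
- case=> N [i Ni]; have [PN _ _] := Ni.
  exact: iii_ii PN (Pification_ring_isomorphic P_R Ni).
- move=> PU; exists (realcompactification R X), (@to_upsilon R X); split => //.
    exact: to_upsilon_continuous.
  move=> Y f PY fcts.
  exact: (hewitt_extension (@pullback_to_upsilon_bijective R X)
    (hewittP _ PY) fcts).
- split=> [PU|[Y [PY XY]]]; last exact: iii_ii PY XY.
  by exists (realcompactification R X); split => //; exact: ring_isomorphic_sym.
- move=> Y PY XY N i Ni; have [PN _ _] := Ni.
  apply: (hewitt_homeomorphic (hewittP _ PN) (hewittP _ PY)).
  apply: ring_isomorphic_trans XY; apply: ring_isomorphic_sym.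
  exact: Pification_ring_isomorphic P_R Ni.
Qed.
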